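(* For any real numbers $0 \le x \le y$, there exists a nonempty two-sided shift space $X$ (over a finite alphabet) with $h_E(X) = x$ and $h(X) = y$.
   Context: A two-sided shift space over a finite alphabet $A$ is a subset $X \subset A^{\mathbb{Z}}$ which is closed (product topology) and invariant under the left shift $\sigma$, $(\sigma x)(n) = x(n+1)$. The language $L(X)$ is the set of all finite words appearing in points of $X$, and $L_n(X)$ is the set of words of length $n$ in $L(X)$. The topological entropy is $h(X) = \lim_{n\to\infty}\frac{1}{n}\log|L_n(X)|$. For $w \in L(X)$, the extender set $E_X(w)$ is the set of all pairs $(s,u)$ with $s,u\in L(X)$ such that the concatenation $swu$ occurs in some point of $X$. Set $E_X(n) = \{E_X(w) : w \in L_n(X)\}$. The extender entropy is $h_E(X) = \lim_{n\to\infty}\frac{1}{n}\log|E_X(n)|$ (this limit exists for every shift space). *)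

(* Defs.v *)
From HB Require Import structures.
From mathcomp Require Import all_boot all_order all_algebra finmap.
From mathcomp Require Import all_classical all_reals all_analysis.

Set Implicit Arguments.
Unset Strict Implicit.
Unset Printing Implicit Defensive.

Import Order.TTheory GRing.Theory Num.Theory.
Import numFieldNormedType.Exports.

Local Open Scope classical_set_scope.
Local Open Scope ring_scope.

(* Bi-infinite sequences over A, with the product of the discrete topologies. *)
Definition full_shift (A : finType) : topologicalType :=
  {ptws int -> discrete_topology A}.

Definition shift (A : finType) (x : full_shift A) : full_shift A :=
  fun n : int => x (n + 1).

(* On two-sided sequences, shift invariance is sigma(X) = X; a closed X with
   only sigma(X) included in X need not satisfy it. *)
Definition shift_space (A : finType) (X : set (full_shift A)) : Prop :=
  closed X /\ @shift A @` X = X.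

Definition occurs_in (A : finType) (w : seq A) (x : full_shift A) : Prop :=
  exists i : int, w = mkseq (fun k : nat => x (i + k%:Z)) (size w).

Definition language (A : finType) (X : set (full_shift A)) : set (seq A) :=
  [set w | exists2 x, X x & occurs_in w x].

Definition language_of_length (A : finType) (X : set (full_shift A)) (n : nat) :
    set (n.-tuple A) :=
  [set w : n.-tuple A | language X w].
Arguments language_of_length {A} X n _.

Definition extender_set (A : finType) (X : set (full_shift A)) (w : seq A) :
    set (seq A * seq A) :=
  [set su | [/\ language X su.1, language X su.2
              & language X (su.1 ++ w ++ su.2)]].

Definition extender_sets (A : finType) (X : set (full_shift A)) (n : nat) :
    set (set (seq A * seq A)) :=
  [set extender_set X w | w in language_of_length X n].

(* [fset_set] is the empty finite set on infinite sets; the two facts below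
   ensure that the cardinals used in the entropies are the genuine ones. *)
Lemma finite_language_of_length (A : finType) (X : set (full_shift A)) n :
  finite_set (language_of_length X n).
Proof. exact: finite_finset. Qed.

Lemma finite_extender_sets (A : finType) (X : set (full_shift A)) n :
  finite_set (extender_sets X n).
Proof. exact/finite_image/finite_language_of_length. Qed.

(* Entropies are stated as convergence, since [lim] of a divergent sequence is
   an arbitrary value. The logarithm is natural. *)
Definition has_topological_entropy (R : realType) (A : finType)
    (X : set (full_shift A)) (h : R) : Prop :=
  (fun n : nat => ln (#|` fset_set (language_of_length X n)|%:R : R) / n%:R)
    @ \oo --> h.

Definition has_extender_entropy (R : realType) (A : finType)
    (X : set (full_shift A)) (h : R) : Prop :=
  (fun n : nat => ln (#|` fset_set (extender_sets X n)|%:R : R) / n%:R)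
    @ \oo --> h.

(* Main.v *)
(* The points whose finite words all occur in a given set Z of sequences form a
   shift space with the language of Z, so it suffices to choose Z. Colour the
   ones of a mechanical (Sturmian) sequence of density g with K colours. This
   sequence has at most n + 1 factors of length n, each with n g ones up to an
   error of 1, so there are K^(n g) coloured words up to a polynomial factor.
   Z contains two kinds of points, on disjoint alphabets:
   - coloured points of density h = y / ln K: they give the entropy h ln K = y,
     but the extender set of a word depends only on which positions are
     coloured, so they contribute at most n + 1 extender sets;
   - points ... c_2 c_1 # c_1 c_2 ... mirrored at a single centre #, where the
     c_i are coloured with density g = x / ln K: the word w # v occurs, for v of
     the length of w, only if v is the reversal of w, so the words without #
     have distinct extender sets. They contribute K^(n g) extender sets, up to a
     polynomial factor counting the factors and the positions of #. *)
Require Import Defs.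
From HB Require Import structures.
From mathcomp Require Import all_boot all_order all_algebra finmap zify lra.
From mathcomp Require Import all_classical all_reals all_analysis.

Set Implicit Arguments.
Unset Strict Implicit.
Unset Printing Implicit Defensive.

Import Order.TTheory GRing.Theory Num.Theory.
Import numFieldNormedType.Exports.

Local Open Scope classical_set_scope.
Local Open Scope ring_scope.

(** * Shift spaces described by their words *)

Lemma nbhs_cylinder (A : finType) (x : full_shift A) (i : int) (n : nat) :
  nbhs x [set z : full_shift A |
    mkseq (fun k => z (i + k%:Z)) n = mkseq (fun k => x (i + k%:Z)) n].
Proof.
elim: n => [|n IHn]; first by apply: filterS filterT => z _.
have xn : nbhs x (proj (i + n%:Z) @^-1` [set x (i + n%:Z)] : set (full_shift A)).
  apply: (@proj_continuous int (fun=> discrete_topology A)).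
  exact: discrete_set1.
apply: filterS (filterI IHn xn) => z [/= IHz zn].
by rewrite !mkseqS IHz (zn : z (i + n%:Z) = x (i + n%:Z)).
Qed.

(** This is the closure of the union of the orbits of the points of [Z]; describing it by words
    gives its language at once. *)
Definition generated_shift (A : finType) (Z : set (full_shift A)) :
    set (full_shift A) :=
  [set x | forall w, occurs_in w x -> language Z w].

Lemma sub_generated_shift (A : finType) (Z : set (full_shift A)) :
  Z `<=` generated_shift Z.
Proof. by move=> x Zx w wx; exists x. Qed.

Lemma language_generated_shift (A : finType) (Z : set (full_shift A)) :
  language (generated_shift Z) = language Z.
Proof.
apply/seteqP; split=> w [x Xx wx]; first exact: Xx.
by exists x => //; apply: sub_generated_shift.
Qed.

Lemma generated_shift_space (A : finType) (Z : set (full_shift A)) :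
  shift_space (generated_shift Z).
Proof.
split.
  move=> x clx w [i wE].
  have [z [Xz /= zx]] := clx _ (nbhs_cylinder x i (size w)).
  by apply: Xz; exists i; rewrite zx.
(* Occurrences may start at any integer, so a point and its shift have the same words. *)
have occ_shift (x : full_shift A) w : occurs_in w (Defs.shift x) <-> occurs_in w x.
  split=> -[i wE].
    exists (i + 1); rewrite wE size_mkseq; apply: eq_mkseq => k.
    by rewrite /Defs.shift addrAC.
  exists (i - 1); rewrite wE size_mkseq; apply: eq_mkseq => k.
  by rewrite /Defs.shift addrAC subrK.
apply/seteqP; split=> [_ [x Xx <-] w /occ_shift|x Xx]; first exact: Xx.
have shiftK : Defs.shift ((fun n => x (n - 1)) : full_shift A) = x.
  by apply/funext => n; rewrite /Defs.shift addrK.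
exists (fun n => x (n - 1)) => // w /(occ_shift _ _).2.
by rewrite shiftK; apply: Xx.
Qed.

(** * Mechanical sequences: density and factors *)

(* Coding of the rotation by [g]; for [0 <= g <= 1] it has density [g] and at
   most [n + 1] factors of length [n]. *)
Definition mechanical (R : realType) (g : R) (m : int) : bool :=
  Num.floor (m%:~R * g) < Num.floor ((m + 1)%:~R * g).

(** As [0 <= g <= 1], the floor of [m g] grows by 0 or 1 at each step, so the comparison is the
    increment itself. Sums then telescope. *)
Lemma mechanical_floor (R : realType) (g : R) (m : int) : 0 <= g <= 1 ->
  (mechanical g m)%:Z = Num.floor ((m + 1)%:~R * g) - Num.floor (m%:~R * g).
Proof.
move=> /andP[g0 g1]; rewrite /mechanical intrD mulrDl mul1r.
set r := m%:~R * g.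
have le1 : Num.floor r <= Num.floor (r + g) by apply: le_floor; rewrite lerDl.
have le2 : Num.floor (r + g) <= Num.floor r + 1.
  have : Num.floor (r + g) <= Num.floor (r + 1) by apply: le_floor; rewrite lerD2l.
  have := @floorDrz R r 1 (rpred1 _). by rewrite floor1 => ->.
move: (Num.floor r) (Num.floor (r + g)) le1 le2 => u v.
by case: (ltP u v) => /= ? ? ?; lia.
Qed.

Lemma mechanical_sum (R : realType) (g : R) (s : int) (n : nat) : 0 <= g <= 1 ->
  ((\sum_(i < n) mechanical g (s + i%:Z))%N)%:Z =
    Num.floor ((s + n%:Z)%:~R * g) - Num.floor (s%:~R * g).
Proof.
move=> g01; elim: n => [|n IHn]; first by rewrite big_ord0 addr0 subrr.
rewrite big_ord_recr /= PoszD IHn mechanical_floor//.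
have -> : s + n.+1%:Z = s + n%:Z + 1 by lia.
lia.
Qed.

Lemma mechanical_density (R : realType) (g : R) (s : int) (n : nat) :
  0 <= g <= 1 ->
  n%:R * g - 1 <= (\sum_(i < n) mechanical g (s + i%:Z))%N%:R <= n%:R * g + 1.
Proof.
move=> g01.
have -> : (\sum_(i < n) mechanical g (s + i%:Z))%N%:R =
    (Num.floor ((s + n%:Z)%:~R * g))%:~R - (Num.floor (s%:~R * g))%:~R :> R.
  by rewrite -intrB -mechanical_sum.
have := floor_itv ((s + n%:Z)%:~R * g); have := floor_itv (s%:~R * g).
rewrite !intrD !mulrDl -pmulrn; lra.
Qed.

Lemma mechanical_factor (R : realType) (g : R) (s : int) (n : nat) :
  exists j : 'I_n.+1, forall i, (i < n)%N ->
    mechanical g (s + i%:Z) = mechanical g (i%:Z - j%:Z).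
Proof.
(* [F i] is the fractional part of [(s + i) g], and [j] minimises it over [0 <= i <= n]. Hence
   [F i - F j] lies in [[0, 1)], and the floor of [(i - j) g] is a difference of floors. The index
   [n] is included because the last letter compares the floors at [n - 1] and [n]. *)
pose F (i : int) : R := (s + i)%:~R * g - (Num.floor ((s + i)%:~R * g))%:~R.
case: (@arg_minP _ _ _ ord0 xpredT (fun j : 'I_n.+1 => F j)) => // j _ jmin.
have floorE i : (i <= n)%N -> Num.floor ((i%:Z - j%:Z)%:~R * g) =
    Num.floor ((s + i%:Z)%:~R * g) - Num.floor ((s + j%:Z)%:~R * g).
  move=> le_in; apply: floor_def.
  have := jmin (Ordinal (le_in : (i < n.+1)%N)) isT.
  rewrite /F /=.
  have := floor_itv ((s + i%:Z)%:~R * g); have := floor_itv ((s + j%:Z)%:~R * g).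
  rewrite !intrB !intrD !mulrDl !mulNr; lra.
exists j => i lt_in; rewrite /mechanical.
have -> : i%:Z - j%:Z + 1 = i.+1%:Z - j%:Z by lia.
have -> : s + i%:Z + 1 = s + i.+1%:Z by lia.
by rewrite !floorE// 1?ltnW// ltrD2r.
Qed.

(** * Counting colourings; cardinals by covering and by injection *)

Definition coloured (k n : nat) (c : nat -> bool) :
    {set {ffun 'I_n -> option 'I_k}} :=
  [set f : {ffun 'I_n -> option 'I_k} | [forall i, isSome (f i) == c i]].

(** Each free position contributes a factor [k], every other one a factor 1. *)
Lemma card_coloured (k n : nat) (c : nat -> bool) :
  #|coloured k n c| = (k ^ \sum_(i < n) c i)%N.
Proof.
pose F (i : 'I_n) := [pred o : option 'I_k | isSome o == c i].
have -> : #|coloured k n c| = #|family F|.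
  by apply: eq_card => f; rewrite inE; apply/forallP/familyP.
rewrite card_family foldrE big_image expn_sum; apply: eq_bigr => i _ /=.
rewrite {}/F; case: (c i).
  have := cardC1 (None : option 'I_k); rewrite card_option card_ord /= => kE.
  by rewrite expn1 -[RHS]kE; apply: eq_card => -[a|].
by rewrite expn0 -(card1 (None : option 'I_k)); apply: eq_card => -[a|].
Qed.

Lemma fset_set_card_le (U : choiceType) (S : set U) (J F : finType)
    (T : J -> {set F}) (g : J -> F -> U) (M : nat) :
  finite_set S -> (forall j, #|T j| <= M)%N ->
  (forall s, S s -> exists j, exists2 f, f \in T j & s = g j f) ->
  (#|` fset_set S| <= #|J| * M)%N.
Proof.
move=> finS TM Sg; pose s := [seq g j f | j <- enum J, f <- enum (T j)].
apply: (@leq_trans (size s)).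
  apply: uniq_leq_size => [|u]; first exact: fset_uniq.
  rewrite in_fset_set// inE => /Sg[j [f Tf ->]].
  by apply/allpairsPdep; exists j, f; rewrite !mem_enum.
rewrite size_allpairs_dep sumnE big_map big_enum /= -sum_nat_const.
by apply: leq_sum => j _; rewrite -cardE.
Qed.

Lemma fset_set_card_ge (U : choiceType) (S : set U) (F : finType)
    (T : {set F}) (g : F -> U) :
  finite_set S -> {in T &, injective g} -> (forall f, f \in T -> S (g f)) ->
  (#|T| <= #|` fset_set S|)%N.
Proof.
move=> finS injg Sg; rewrite cardE -(size_map g); apply: uniq_leq_size.
  rewrite map_inj_in_uniq ?enum_uniq// => f f'.
  by rewrite !mem_enum; apply: injg.
by move=> u /mapP[f]; rewrite mem_enum in_fset_set// inE => /Sg ? ->.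
Qed.

(** * Exponential growth rates *)

(** From [ln t = 2 ln (sqrt t) <= 2 sqrt t] and [n + 3 <= 4 (n + 1)]. It makes the logarithm of the
    polynomial factor negligible against [n]. *)
Lemma ln_nat_le_sqrt (R : realType) (n : nat) :
  ln (n.+3%:R : R) <= 4 * Num.sqrt n.+1%:R.
Proof.
have pos3 : 0 < n.+3%:R :> R by rewrite ltr0n.
have s0 : 0 < Num.sqrt n.+3%:R :> R by rewrite sqrtr_gt0.
have -> : n.+3%:R = Num.sqrt n.+3%:R ^+ 2 :> R by rewrite sqr_sqrtr// ltW.
rewrite lnXn// mulr2n.
have := ln_sublinear s0.
have : Num.sqrt n.+3%:R <= 2 * Num.sqrt n.+1%:R :> R.
  have -> : 2 = Num.sqrt (2 ^+ 2) :> R by rewrite sqrtr_sqr ger0_norm.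
  by rewrite -sqrtrM ?ler_wsqrtr// -natrX -natrM ler_nat; lia.
lra.
Qed.

Lemma exponential_growth_rate (R : realType) (k : nat) (g : R) (u : nat -> nat) :
  (0 < k)%N ->
  (forall n, (0 < n)%N ->
     exists2 m : nat, n%:R * g - 1 <= m%:R & (k ^ m <= u n)%N) ->
  (forall n, (0 < n)%N ->
     exists2 m : nat, m%:R <= n%:R * g + 1 & (u n <= n.+2 ^ 2 * k ^ m)%N) ->
  (fun n => ln ((u n)%:R : R) / n%:R) @ \oo --> g * ln k%:R.
Proof.
move=> k0 lower upper; rewrite -cvg_shiftS /=.
set l := ln k%:R.
have l0 : 0 <= l by rewrite ln_ge0// ler1n.
have cvg0 (C : R) : (fun n => g * l + C * Num.sqrt (harmonic n)) @ \oo --> g * l.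
  rewrite -[X in _ --> X]addr0 -[X in _ --> _ + X](mulr0 C).
  rewrite -[in X in _ --> X](@sqrtr0 R).
  apply: cvgD; first exact: cvg_cst.
  apply: cvgM; first exact: cvg_cst.
  apply: (@cvg_comp _ _ _ _ Num.sqrt); first exact: cvg_harmonic.
  exact: sqrt_continuous.
(* At [n + 1] the polynomial factor costs [2 ln (n + 3) <= 8 sqrt (n + 1)], and the error 1 in the
   exponent costs [l <= l sqrt (n + 1)]; both are then divided by [n + 1]. *)
apply: (squeeze_cvgr _ (cvg0 (- l)) (cvg0 (8 + l))).
apply: nearW => n.
have [m mlow um] := lower n.+1 isT; have [m' mup um'] := upper n.+1 isT.
have n0 : 0 < n.+1%:R :> R by rewrite ltr0n.
have u0 : (0 < u n.+1)%N by apply: leq_trans um; rewrite expn_gt0 k0.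
have lnX j : ln (k ^ j)%N%:R = j%:R * l :> R.
  by rewrite natrX lnXn ?ltr0n// mulr_natl.
have low : m%:R * l <= ln (u n.+1)%:R.
  by rewrite -lnX ler_ln ?posrE ?ltr0n ?ler_nat// expn_gt0 k0.
have up : ln (u n.+1)%:R <= 2 * ln n.+3%:R + m'%:R * l.
  rewrite -lnX mulr_natl -lnXn ?ltr0n// -natrX -lnM ?posrE ?ltr0n ?expn_gt0 ?k0//.
  by rewrite -natrM ler_ln ?posrE ?ltr0n ?muln_gt0 ?expn_gt0 ?k0// ler_nat.
have s1 : 1 <= Num.sqrt n.+1%:R :> R.
  by rewrite -[X in X <= _]sqrtr1 ler_wsqrtr// ler1n.
have -> : Num.sqrt (harmonic n) = Num.sqrt n.+1%:R / n.+1%:R :> R.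
  rewrite /harmonic sqrtrV ?ler0n//.
  have sN0 : Num.sqrt n.+1%:R != 0 :> R by rewrite gt_eqF// (lt_le_trans _ s1).
  by apply: (mulfI sN0); rewrite mulfV// mulrA -expr2 sqr_sqrtr ?ler0n// mulfV ?gt_eqF.
have ls := ln_nat_le_sqrt R n.
rewrite ler_pdivlMr// ler_pdivrMr// !mulrDl !mulrA !divfK ?gt_eqF//.
have lowl : (n.+1%:R * g - 1) * l <= m%:R * l by rewrite ler_wpM2r.
have upl : m'%:R * l <= (n.+1%:R * g + 1) * l by rewrite ler_wpM2r.
have ll : l * 1 <= l * Num.sqrt n.+1%:R by rewrite ler_wpM2l.
apply/andP; split; nra.
Qed.

(** * Mirrored points, free points and their languages *)

Lemma occurs_inP (A : finType) (d : A) (w : seq A) (x : full_shift A) :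
  occurs_in w x <->
  exists q : int, forall i, (i < size w)%N -> nth d w i = x (q + i%:Z).
Proof.
split=> -[q wx]; exists q; first by move=> i iw; rewrite wx nth_mkseq.
by apply: (@eq_from_nth _ d) => [|i iw]; rewrite ?size_mkseq// nth_mkseq// wx.
Qed.

Lemma languageU (A : finType) (Y Z : set (full_shift A)) :
  language (Y `|` Z) = language Y `|` language Z.
Proof.
apply/seteqP; split=> [w [x [Yx|Zx] wx]|w [[x Yx wx]|[x Zx wx]]].
- by left; exists x.
- by right; exists x.
- by exists x => //; left.
- by exists x => //; right.
Qed.

(* The letter [None] is the centre of a mirrored point; [Some (b, o)] records
   the kind of point in [b], and [o] is a colour at the free positions and
   [None] at the others. *)
Definition letter (k : nat) : finType := option (bool * option 'I_k).

(** The dependence on the absolute value of [m] makes the point symmetric about 0; [a] is read from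
    index 1 on. *)
Definition mirror_point (k : nat) (a : nat -> option 'I_k) :
    full_shift (letter k) :=
  fun m : int => if m == 0 then None else Some (true, a `|m|%N).

Definition mirror_points (R : realType) (k : nat) (g : R) :
    set (full_shift (letter k)) :=
  [set x | exists2 a : nat -> option 'I_k,
    forall i, isSome (a i) = mechanical g i%:Z & x = mirror_point a].

Arguments mirror_points {R} k g _.

Definition free_points (R : realType) (k : nat) (g : R) :
    set (full_shift (letter k)) :=
  [set x | exists2 a : int -> option 'I_k,
    forall m, isSome (a m) = mechanical g m & x = fun m => Some (false, a m)].

Arguments free_points {R} k g _.

(** Forgets the colours of a free point and sends every letter of a mirrored point to [None], so it
    also separates the two kinds. *)
Definition free_pattern (k : nat) (l : letter k) : option bool :=
  if l is Some (false, o) then Some (isSome o) else None.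

Lemma language_free_pointsP (R : realType) (k : nat) (g : R)
    (w : seq (letter k.+1)) :
  language (free_points k.+1 g) w <->
  exists q : int, map (@free_pattern k.+1) w =
    mkseq (fun i => Some (mechanical g (q + i%:Z))) (size w).
Proof.
split=> [[_ [a aE ->] [q wE]]|[q wE]].
  by exists q; rewrite wE size_mkseq -map_comp; apply: eq_map => i /=; rewrite aE.
(* Colours at distinct positions are independent: [a] takes those of [w] on the window at [q] and
   the colour [ord0] at the free positions outside. *)
pose b m : option 'I_k.+1 := if mechanical g m then Some ord0 else None.
pose a (m : int) := if (q <= m) && (m < q + (size w)%:Z) then
  (if nth None w `|m - q|%N is Some (_, o) then o else None) else b m.
have wi i : (i < size w)%N ->
    free_pattern (nth None w i) = Some (mechanical g (q + i%:Z)).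
  by move=> iw; rewrite -(nth_map _ (Some true))// wE nth_mkseq.
exists (fun m => Some (false, a m)); first exists a => // m.
  rewrite /a; case: ifP => [/andP[qm mq]|_]; last by rewrite /b; case: ifP.
  have qmE : q + `|m - q|%N%:Z = m by lia.
  have lt_size : (`|m - q| < size w)%N by lia.
  by have := wi _ lt_size; rewrite qmE; case: (nth None w _) => [[[] o]|] // [].
apply/(@occurs_inP (letter k.+1) None); exists q => i iw; rewrite /a.
have -> : `|(q + i%:Z - q)%R|%N = i by lia.
have -> : (q <= q + i%:Z) && (q + i%:Z < q + (size w)%:Z) by lia.
by move: (wi i iw); case: (nth None w i) => [[[] o]|].
Qed.

Lemma free_pattern_mirror (R : realType) (k : nat) (g : R)
    (w : seq (letter k)) (l : letter k) :
  language (mirror_points k g) w -> l \in w -> free_pattern l = None.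
Proof.
move=> [_ [a _ ->] [q ->]] /mapP[i _ ->].
by rewrite /mirror_point; case: ifP.
Qed.

Lemma free_pattern_free (R : realType) (k : nat) (g : R)
    (w : seq (letter k)) (l : letter k) :
  language (free_points k g) w -> l \in w -> free_pattern l != None.
Proof. by move=> [_ [a _ ->] [q ->]] /mapP[i _ ->]. Qed.

(** * Words of length [n] of both kinds *)

Definition free_word (k n : nat) (f : {ffun 'I_n -> option 'I_k}) :
    n.-tuple (letter k) :=
  [tuple Some (false, f i) | i < n].

(* The three kinds of windows on a mirrored point: to the right of the centre,
   to its left, and with the centre at position [l]. *)
Definition mirror_word (k n : nat) (v : option (option 'I_n))
    (f : {ffun 'I_n -> option 'I_k}) : n.-tuple (letter k) :=
  match v with
  | None => [tuple Some (true, f i) | i < n]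
  | Some None => [tuple Some (true, f (rev_ord i)) | i < n]
  | Some (Some l) =>
    [tuple if i == l then None else Some (true, f (insubd l `|i%:Z - l%:Z|%N))
      | i < n]
  end.

Lemma eq_tuple_nth (T : Type) (d : T) (n : nat) (w : n.-tuple T) (F : 'I_n -> T) :
  (forall i : 'I_n, nth d w i = F i) -> w = [tuple F i | i < n].
Proof. by move=> wF; apply: eq_from_tnth => i; rewrite tnth_mktuple (tnth_nth d). Qed.

Lemma free_word_cover (R : realType) (k n : nat) (g : R)
    (w : n.-tuple (letter k)) :
  language (free_points k g) w ->
  exists j : 'I_n.+1,
    exists2 f, f \in coloured k n (fun i => mechanical g (i%:Z - j%:Z)) &
      w = free_word f.
Proof.
move=> [_ [a aE ->] /(@occurs_inP (letter k) None)[q wE]].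
have [j jE] := mechanical_factor g q n; exists j.
exists [ffun i : 'I_n => a (q + i%:Z)].
  by rewrite inE; apply/forallP => i; rewrite ffunE aE jE.
by apply: (@eq_tuple_nth (letter k) None) => i; rewrite wE ?size_tuple// ffunE.
Qed.

(** In each of the three positions relative to the centre, a window is determined by [n] consecutive
    entries of [a] from some [s >= 0], and their free positions form one of the [n + 1] mechanical
    factors. *)
Lemma mirror_word_cover (R : realType) (k n : nat) (g : R)
    (w : n.-tuple (letter k)) :
  language (mirror_points k g) w ->
  exists vj : option (option 'I_n) * 'I_n.+1,
    exists2 f, f \in coloured k n (fun i => mechanical g (i%:Z - vj.2%:Z)) &
      w = mirror_word vj.1 f.
Proof.
move=> [_ [a aE ->] /(@occurs_inP (letter k) None)[q]]; rewrite size_tuple => wE.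
have cov v (s : nat) : w = mirror_word v [ffun i : 'I_n => a (s + i)%N] ->
    exists vj : option (option 'I_n) * 'I_n.+1,
    exists2 f, f \in coloured k n (fun i => mechanical g (i%:Z - vj.2%:Z)) &
      w = mirror_word vj.1 f.
  move=> wv; have [j jE] := mechanical_factor g s%:Z n; exists (v, j) => /=.
  exists [ffun i : 'I_n => a (s + i)%N] => //.
  by rewrite inE; apply/forallP => i; rewrite ffunE aE PoszD jE.
have [q0|q0] := ltP 0 q.
  apply: (cov None `|q|%N).
  apply: (@eq_tuple_nth (letter k) None) => i.
  rewrite wE// ffunE /mirror_point; case: eqP => [|_]; first by lia.
  by congr (Some (true, a _)); lia.
have [qn|qn] := leP (q + n%:Z) 0.
  (* The last position of the window is the closest to the centre, and [a] is read backwards from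
     there. *)
  apply: (cov (Some None) `|(q + n%:Z - 1)%R|%N).
  apply: (@eq_tuple_nth (letter k) None) => i.
  have := ltn_ord i; rewrite wE// ffunE /mirror_point => lt_in.
  case: eqP => [|_]; first by lia.
  by congr (Some (true, a _)); rewrite /=; lia.
have ln : (`|q| < n)%N by lia.
apply: (cov (Some (Some (Ordinal ln))) 0%N); apply: (@eq_tuple_nth (letter k) None) => i.
have lt_in := ltn_ord i; rewrite wE// /mirror_point -val_eqE /=.
have -> : (q + i%:Z == 0) = (i == `|q| :> nat)%N by apply/eqP/eqP; lia.
case: eqP => // _; rewrite ffunE val_insubd /=.
by congr (Some (true, a _)); case: ifP; lia.
Qed.

Lemma map_free_pattern_free_word (k n : nat) (c : nat -> bool) f :
  f \in coloured k n c ->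
  map (@free_pattern k) (free_word f) = mkseq (fun i => Some (c i)) n.
Proof.
rewrite inE => /forallP fc; rewrite /mkseq -val_enum_ord -!map_comp.
by apply: eq_map => i /=; rewrite (eqP (fc i)).
Qed.

Lemma free_word_inj (k n : nat) : injective (@free_word k n).
Proof.
move=> f f' /(congr1 (fun w => tnth w)) ff'; apply/ffunP => i.
by have := congr1 (@^~ i) ff'; rewrite /= !tnth_mktuple => -[].
Qed.

Lemma language_free_word (R : realType) (k n : nat) (g : R) f :
  f \in coloured k.+1 n (fun i => mechanical g i%:Z) ->
  language (free_points k.+1 g) (free_word f).
Proof.
move=> fc; apply/language_free_pointsP; exists 0.
rewrite (map_free_pattern_free_word fc) size_tuple.
by apply: eq_mkseq => i; rewrite add0r.
Qed.

(** * The shift space and its extender sets *)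

Definition two_kind_shift (R : realType) (k : nat) (g h : R) :
    set (full_shift (letter k)) :=
  generated_shift (mirror_points k g `|` free_points k h).
Arguments two_kind_shift {R} k g h _.

Lemma language_two_kind (R : realType) (k : nat) (g h : R) :
  language (two_kind_shift k g h) =
  language (mirror_points k g) `|` language (free_points k h).
Proof. by rewrite language_generated_shift languageU. Qed.

(* A nonempty word of a free point never extends to a word of a mirrored one,
   and membership in the language of free points depends on patterns only. *)
Lemma extender_set_free (R : realType) (k : nat) (g h : R)
    (w w' : seq (letter k.+1)) :
  w != [::] -> language (free_points k.+1 h) w ->
  map (@free_pattern k.+1) w = map (@free_pattern k.+1) w' ->
  extender_set (two_kind_shift k.+1 g h) w
    `<=` extender_set (two_kind_shift k.+1 g h) w'.
Proof.
move=> w0 wh ww' [s u] [/= Ls Lu Lswu]; split => //=.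
move: Lswu; rewrite language_two_kind => -[Lg|Lh].
  case: w w0 wh Lg {ww'} => // l w _ wh Lg.
  have := free_pattern_free wh (mem_head l w).
  by rewrite (free_pattern_mirror Lg)// mem_cat mem_head orbT.
right; apply/language_free_pointsP.
have [q] := (language_free_pointsP _ _).1 Lh; exists q.
have sw : size w = size w' by rewrite -(size_map (@free_pattern _) w) ww' size_map.
by rewrite !map_cat -ww' -!map_cat !size_cat -sw -!size_cat.
Qed.

Lemma nth_mirror_word_right (k n : nat) (f : {ffun 'I_n -> option 'I_k})
    (i : 'I_n) :
  nth (None : letter k) (mirror_word None f) i = Some (true, f i).
Proof. exact: nth_mktuple. Qed.

Lemma nth_mirror_word_left (k n : nat) (f : {ffun 'I_n -> option 'I_k})
    (i : 'I_n) :
  nth (None : letter k) (mirror_word (Some None) f) i = Some (true, f (rev_ord i)).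
Proof. exact: nth_mktuple. Qed.

Lemma size_mirror_extension (k n : nat) (f f' : {ffun 'I_n -> option 'I_k}) :
  size (mirror_word (Some None) f' ++ None :: mirror_word None f) = (n + n.+1)%N.
Proof. by rewrite -cat1s !size_cat !size_tuple. Qed.

Lemma mirror_extension (R : realType) (k n : nat) (g : R) f :
  f \in coloured k.+1 n (fun i => mechanical g (1 + i%:Z)) ->
  language (mirror_points k.+1 g)
    (mirror_word (Some None) f ++ None :: mirror_word None f).
Proof.
rewrite inE => /forallP fc.
(* [f] gives the entries [1] to [n] of [a]. The test [0 < i] excludes the index 0, whose truncated
   predecessor is also 0. *)
pose a i : option 'I_k.+1 := if insub i.-1 is Some j then
  if (0 < i)%N then f j else if mechanical g i%:Z then Some ord0 else None
  else if mechanical g i%:Z then Some ord0 else None.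
exists (mirror_point a).
  exists a => // -[|i]; rewrite /a.
    by case: insubP => [j _ _|_]; case: ifP.
  case: insubP => [j _ /= ji|_]; last by case: ifP.
  by rewrite (eqP (fc j)) ji; congr (mechanical g _); lia.
apply/(@occurs_inP (letter k.+1) None); exists (- n%:Z) => i.
rewrite size_mirror_extension nth_cat size_tuple /mirror_point => i_lt.
case: (ssrnat.ltngtP i n) => in_.
- have -> : (- n%:Z + i%:Z == 0) = false by apply/negbTE/eqP; lia.
  rewrite (nth_mirror_word_left f (Ordinal in_)) /a.
  case: insubP => [j _ /= ji|]; last by rewrite -leqNgt; lia.
  have -> : (0 < `|(- n%:Z + i%:Z)%R|)%N by lia.
  by congr (Some (true, f _)); apply: val_inj; rewrite /= ji; lia.
- have -> : (- n%:Z + i%:Z == 0) = false by apply/negbTE/eqP; lia.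
  have lt_in : ((i - n).-1 < n)%N by lia.
  have -> : (i - n = (Ordinal lt_in).+1)%N by rewrite /=; lia.
  rewrite [LHS](nth_mirror_word_right f) /a.
  case: insubP => [j _ /= ji|]; last by rewrite -leqNgt; lia.
  have -> : (0 < `|(- n%:Z + i%:Z)%R|)%N by lia.
  by congr (Some (true, f _)); apply: val_inj; rewrite /= ji; lia.
- by rewrite in_ subnn ifT//; apply/eqP; lia.
Qed.

(** The letter [None] at index [n] must be the centre, which forces [q = - n]; then [f i] and [f' i]
    are both [a (i + 1)]. *)
Lemma mirror_extension_inj (R : realType) (k n : nat) (g : R)
    (f f' : {ffun 'I_n -> option 'I_k}) :
  language (mirror_points k g)
    (mirror_word (Some None) f' ++ None :: mirror_word None f) -> f' = f.
Proof.
move=> [_ [a _ ->] /(@occurs_inP (letter k) None)[q]].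
rewrite size_mirror_extension => wE.
have qE : q = - n%:Z.
  have := wE n; rewrite nth_cat size_tuple ltnn subnn /mirror_point /=.
  by case: eqP => [? _|_ /(_ ltac:(lia))//]; lia.
apply/ffunP => i; have lt_in := ltn_ord i.
have fR : Some (true, f i) = mirror_point a (q + (n + i.+1)%N%:Z).
  rewrite -wE ?ltn_add2l// nth_cat size_tuple ltnNge leq_addr addKn.
  exact/esym/nth_mirror_word_right.
have fL : Some (true, f' i) = mirror_point a (q + (rev_ord i)%:Z).
  rewrite -wE ?ltn_addr// nth_cat size_tuple ltn_ord.
  by rewrite nth_mirror_word_left rev_ordK.
move: fL fR; rewrite /mirror_point qE /=.
have -> : (- n%:Z + (n + i.+1)%N%:Z == 0) = false by apply/negbTE/eqP; lia.
have -> : (- n%:Z + (n - i.+1)%N%:Z == 0) = false by apply/negbTE/eqP; lia.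
by move=> [->] [->]; congr (a _); lia.
Qed.

Lemma extender_set_mirror_inj (R : realType) (k n : nat) (g h : R) :
  {in coloured k.+1 n (fun i => mechanical g (1 + i%:Z)) &,
    injective (fun f => extender_set (two_kind_shift k.+1 g h)
                          (mirror_word (Some None) f))}.
Proof.
move=> f f' fc _ ff'; apply/esym.
(* Extender sets require both sides of the pair to be in the language, hence this closure under
   prefixes and suffixes. *)
have sub s w : language (two_kind_shift k.+1 g h) (s ++ w) ->
    language (two_kind_shift k.+1 g h) s /\ language (two_kind_shift k.+1 g h) w.
  move=> [x Xx /(@occurs_inP (letter k.+1) None)[q]]; rewrite size_cat => swE.
  split; exists x => //; apply/(@occurs_inP (letter k.+1) None).
    by exists q => i si; rewrite -swE ?nth_cat ?si// ltn_addr.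
  exists (q + (size s)%:Z) => i wi; rewrite -addrA -PoszD -swE ?ltn_add2l//.
  by rewrite nth_cat ltnNge leq_addr /= addKn.
have Lf : language (two_kind_shift k.+1 g h)
    (mirror_word (Some None) f ++ None :: mirror_word None f).
  by rewrite language_two_kind; left; apply: mirror_extension.
(* This pair distinguishes the words: moved to the extender set of the word of [f'], it gives a word
   containing [None], hence of a mirrored point, which forces [f' = f]. *)
have : extender_set (two_kind_shift k.+1 g h) (mirror_word (Some None) f)
    ([::], None :: tval (mirror_word None f)).
  split => //=; last by have [] := sub _ _ Lf.
  by have [] := sub [::] _ Lf.
rewrite ff' => -[_ _] /=; rewrite language_two_kind => -[|Lh].
  exact: mirror_extension_inj.
have None_in : None \in mirror_word (Some None) f' ++ None :: mirror_word None f.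
  by rewrite mem_cat mem_head orbT.
by have := free_pattern_free Lh None_in.
Qed.

(** * The two entropies *)

Lemma card_coloured_mechanical_le (R : realType) (k n : nat) (g r : R) (s : int) :
  0 <= g <= 1 -> n%:R * g + 1 <= r ->
  (#|coloured k.+1 n (fun i => mechanical g (i%:Z - s))| <=
     k.+1 ^ Num.truncn r)%N.
Proof.
move=> g01 gr; rewrite card_coloured leq_pexp2l// -ltnS.
under eq_bigr do rewrite addrC.
rewrite -(ltr_nat R); have /andP[_ le_sum] := mechanical_density (- s) n g01.
apply: le_lt_trans (le_trans le_sum gr) _.
exact: truncnS_gt.
Qed.

Lemma two_kind_topological_entropy (R : realType) (k : nat) (g h : R) :
  0 <= g -> g <= h -> h <= 1 ->
  has_topological_entropy (two_kind_shift k.+1 g h) (h * ln k.+1%:R).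
Proof.
move=> g0 gh h1; have h01 : 0 <= h <= 1 by rewrite (le_trans g0 gh).
have g01 : 0 <= g <= 1 by rewrite g0 (le_trans gh h1).
apply: exponential_growth_rate => // n n0.
  exists (\sum_(i < n) mechanical h (0 + i%:Z))%N.
    by have /andP[] := mechanical_density 0 n h01.
  rewrite -(@card_coloured k.+1 n (fun i => mechanical h (0 + i%:Z))).
  apply: (fset_set_card_ge (g := @free_word k.+1 n)).
  - exact: finite_language_of_length.
  - by move=> f f' _ _; apply: free_word_inj.
  - move=> f fc; rewrite /language_of_length /= language_two_kind; right.
    by apply: language_free_word; rewrite inE in fc *.
have r0 : 0 <= n%:R * h + 1 :> R.
  by rewrite addr_ge0// mulr_ge0//; case/andP: h01.
exists (Num.truncn (n%:R * h + 1)); first by rewrite truncn_le.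
pose J : finType := ((option (option 'I_n) * 'I_n.+1) + 'I_n.+1)%type.
pose T (j : J) := match j with
  | inl vj => coloured k.+1 n (fun i => mechanical g (i%:Z - vj.2%:Z))
  | inr j => coloured k.+1 n (fun i => mechanical h (i%:Z - j%:Z)) end.
pose w (j : J) := match j with
  | inl vj => @mirror_word k.+1 n vj.1 | inr j => @free_word k.+1 n end.
(* There are [(n + 2) (n + 1)] mirrored shapes and [n + 1] free ones, in all
   [(n + 1) (n + 3) <= (n + 2)^2]. *)
apply: (@leq_trans (#|J| * k.+1 ^ Num.truncn (n%:R * h + 1))%N); last first.
  by rewrite leq_mul2r card_sum card_prod !card_option !card_ord; apply/orP; right; nia.
apply: (fset_set_card_le (T := T) (g := w)).
- exact: finite_language_of_length.
(* Since [g <= h], the bound for density [h] covers the mirrored words too. *)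
- have coloured_le s (b : R) : 0 <= b <= 1 -> b <= h ->
      (#|coloured k.+1 n (fun i => mechanical b (i%:Z - s))| <=
         k.+1 ^ Num.truncn (n%:R * h + 1))%N.
    move=> b01 bh; apply: card_coloured_mechanical_le => //.
    by rewrite lerD2r ler_wpM2l.
  by case=> [vj|j]; apply: coloured_le.
- move=> t; rewrite /language_of_length /= language_two_kind => -[].
    by move=> /mirror_word_cover[vj [f fc ->]]; exists (inl vj), f.
  by move=> /free_word_cover[j [f fc ->]]; exists (inr j), f.
Qed.

Lemma two_kind_extender_entropy (R : realType) (k : nat) (g h : R) :
  0 <= g <= 1 ->
  has_extender_entropy (two_kind_shift k.+1 g h) (g * ln k.+1%:R).
Proof.
move=> g01; set X := two_kind_shift k.+1 g h.
apply: exponential_growth_rate => // n n0.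
  exists (\sum_(i < n) mechanical g (1 + i%:Z))%N.
    by have /andP[] := mechanical_density 1 n g01.
  rewrite -(@card_coloured k.+1 n (fun i => mechanical g (1 + i%:Z))).
  apply: (fset_set_card_ge
            (g := fun f => extender_set X (mirror_word (Some None) f))).
  - exact: finite_extender_sets.
  - exact: extender_set_mirror_inj.
  - move=> f fc; exists (mirror_word (Some None) f) => //.
    rewrite /language_of_length /= language_two_kind; left.
    have [x Xx /(@occurs_inP (letter k.+1) None)[q wE]] := mirror_extension fc.
    exists x => //; apply/(@occurs_inP (letter k.+1) None); exists q => i i_lt.
    by rewrite -wE ?nth_cat ?i_lt// size_cat ltn_addr.
have r0 : 0 <= n%:R * g + 1 :> R.
  by rewrite addr_ge0// mulr_ge0//; case/andP: g01.
exists (Num.truncn (n%:R * g + 1)); first by rewrite truncn_le.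
(* One colouring per mechanical factor suffices for the free words, as their extender sets depend on
   the pattern only. *)
pose c j (i : 'I_n) : option 'I_k.+1 :=
  if mechanical h (i%:Z - j) then Some ord0 else None.
pose J : finType := ((option (option 'I_n) * 'I_n.+1) + 'I_n.+1)%type.
pose T (j : J) := match j with
  | inl vj => coloured k.+1 n (fun i => mechanical g (i%:Z - vj.2%:Z))
  | inr j => [set finfun (c j%:Z)]%SET end.
pose w (j : J) := match j with
  | inl vj => @mirror_word k.+1 n vj.1 | inr j => @free_word k.+1 n end.
apply: (@leq_trans (#|J| * k.+1 ^ Num.truncn (n%:R * g + 1))%N); last first.
  by rewrite leq_mul2r card_sum card_prod !card_option !card_ord; apply/orP; right; nia.
apply: (fset_set_card_le (T := T) (g := fun j f => extender_set X (w j f))).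
- exact: finite_extender_sets.
- case=> [vj|j] /=; last by rewrite cards1 expn_gt0.
  exact: card_coloured_mechanical_le.
- move=> _ [t + <-]; rewrite /language_of_length /= language_two_kind => -[].
    by move=> /mirror_word_cover[vj [f fc ->]]; exists (inl vj), f.
  move=> tL; have [j [f fc tE]] := free_word_cover tL; exists (inr j).
  exists (finfun (c j%:Z)); first by rewrite /= inE.
  have cj : finfun (c j%:Z) \in coloured k.+1 n (fun i => mechanical h (i%:Z - j%:Z)).
    by rewrite inE; apply/forallP => i; rewrite ffunE /c; case: ifP.
  have pat : map (@free_pattern k.+1) t =
      map (@free_pattern k.+1) (free_word (finfun (c j%:Z))).
    by rewrite tE (map_free_pattern_free_word fc) (map_free_pattern_free_word cj).
  have nonempty (u : n.-tuple (letter k.+1)) : tval u != [::].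
    by rewrite -size_eq0 size_tuple -lt0n.
  apply/seteqP; split; apply: extender_set_free => //.
  apply/language_free_pointsP.
  by rewrite -pat; move/language_free_pointsP: tL; rewrite !size_tuple.
Qed.

(** * Choice of the number of colours and of the densities *)

Unset Implicit Arguments.

Theorem theorem4p3 (R : realType) (x y : R) (hx : 0 <= x) (hxy : x <= y) :
  exists (A : finType) (X : set (full_shift A)),
    [/\ shift_space X, X !=set0,
        has_extender_entropy X x & has_topological_entropy X y].
Proof.
(* With [k + 1 > expR y >= 1] colours, [l] is positive and at least [y], so [x / l <= y / l <= 1]
   are valid densities. *)
pose k := Num.truncn (expR y); pose l : R := ln k.+1%:R.
have y0 : 0 <= y by apply: le_trans hxy.
have yl : y <= l.
  rewrite -(expRK y) ler_ln ?posrE ?expR_gt0 ?ltr0n//.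
  by apply/ltW/truncnS_gt.
have l0 : 0 < l.
  rewrite ln_gt0// ltr1n ltnS truncn_gt0.
  by rewrite -expR0 ler_expR.
have xE : x = x / l * l by rewrite divfK// gt_eqF.
have yE : y = y / l * l by rewrite divfK// gt_eqF.
have xl0 : 0 <= x / l by rewrite divr_ge0// ltW.
have xyl : x / l <= y / l by rewrite ler_pM2r// invr_gt0.
have yl1 : y / l <= 1 by rewrite ler_pdivrMr// mul1r.
exists (letter k.+1), (two_kind_shift k.+1 (x / l) (y / l)); split.
- exact: generated_shift_space.
- pose b m : option 'I_k.+1 := if mechanical (y / l) m then Some ord0 else None.
  exists (fun m => Some (false, b m)).
  apply: sub_generated_shift; right; exists b => // m.
  by rewrite /b; case: ifP.
- rewrite [X in has_extender_entropy _ X]xE.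
  by apply: two_kind_extender_entropy; rewrite xl0 (le_trans xyl).
- rewrite [X in has_topological_entropy _ X]yE.
  exact: two_kind_topological_entropy.
Qed.
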